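(* Let $(X,d)$ and $(Y,\rho)$ be ultrametric spaces, let $\eta\colon[0,\infty)\to[0,\infty)$ be a homeomorphism, and let $f\colon X\to Y$ be an $\eta$-quasisymmetric embedding. Then $f$ maps bounded subspaces of $X$ to bounded subspaces of $Y$. Moreover, if $A\subseteq B\subseteq X$ with $\operatorname{diam} A>0$ and $\operatorname{diam} B<\infty$, then $\operatorname{diam} f(B)$ is finite and $$ \frac{1}{\eta\left(\frac{\operatorname{diam} B}{\operatorname{diam} A}\right)}\leqslant \frac{\operatorname{diam} f(A)}{\operatorname{diam} f(B)}\leqslant \eta\left(\frac{\operatorname{diam} A}{\operatorname{diam} B}\right). $$
   Context: An ultrametric space is a metric space $(X,d)$ satisfying $d(x,y)\leqslant\max\{d(x,z),d(z,y)\}$ for all $x,y,z\in X$. An embedding between metric spaces is an injective continuous mapping that is a homeomorphism onto its image. Given a homeomorphism $\eta\colon[0,\infty)\to[0,\infty)$, an embedding $f\colon X\to Y$ between metric spaces $(X,d)$ and $(Y,\rho)$ is $\eta$-quasisymmetric if for all $a,b,x\in X$ and all $t>0$, $d(x,a)\leqslant t\,d(x,b)$ implies $\rho(f(x),f(a))\leqslant\eta(t)\,\rho(f(x),f(b))$. The diameter of a set is the supremum of the distances between its points. *)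

(* Defs.v *)
From HB Require Import structures.
From mathcomp Require Import all_boot all_order all_algebra.
From mathcomp Require Import all_classical all_reals all_analysis.

Set Implicit Arguments.
Unset Strict Implicit.
Unset Printing Implicit Defensive.

Import Order.TTheory GRing.Theory Num.Theory.
Import numFieldNormedType.Exports.

Local Open Scope classical_set_scope.
Local Open Scope ring_scope.

Definition homeomorphism (T U : topologicalType) (h : T -> U) : Prop :=
  continuous h /\
  exists g : U -> T, [/\ cancel h g, cancel g h & continuous g].

(* The sets A and B, seen as types, carry their subspace topologies; the values
   of f outside A are irrelevant. *)
Definition homeomorphism_on (T U : topologicalType) (A : set T) (B : set U)
    (f : T -> U) : Prop :=
  exists2 h : A -> B, homeomorphism h & forall x : A, val (h x) = f (val x).

Definition embedding (T U : topologicalType) (f : T -> U) : Prop :=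
  [/\ injective f, continuous f & homeomorphism_on [set: T] (range f) f].

Section metric.
Context {R : realType}.

Definition ultrametric (X : metricType R) : Prop :=
  forall x y z : X, mdist x y <= Num.max (mdist x z) (mdist z y).

(* With this definition the empty set has diameter -oo. *)
Definition diam (X : metricType R) (A : set X) : \bar R :=
  ereal_sup [set (mdist x y)%:E | x in A & y in A].

Definition metric_bounded (X : metricType R) (A : set X) : Prop :=
  (diam A < +oo)%E.

Definition quasisymmetric_embedding (X Y : metricType R) (eta : R -> R)
    (f : X -> Y) : Prop :=
  embedding f /\
  forall (a b x : X) (t : R), 0 < t ->
    mdist x a <= t * mdist x b ->
    mdist (f x) (f a) <= eta t * mdist (f x) (f b).

End metric.

(* Main.v *)
(* In an ultrametric space, the diameter of a set is the supremum of the
   distances to any one of its points. If x lies in both P and Q, then for b in Q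
   other than x, quasisymmetry bounds rho(f x, f a), for every a in P, by
   eta(diam P / d(x, b)) diam f(Q). Letting d(x, b) tend to diam Q, continuity of
   eta gives diam f(P) <= eta(diam P / diam Q) diam f(Q). *)
Require Import Defs.
From HB Require Import structures.
From mathcomp Require Import all_boot all_order all_algebra.
From mathcomp Require Import all_classical all_reals all_analysis.

Set Implicit Arguments.
Unset Strict Implicit.

Import Order.TTheory GRing.Theory Num.Theory.
Import numFieldNormedType.Exports.

Local Open Scope classical_set_scope.
Local Open Scope ring_scope.

(** Near an interior point of [A], the neighbourhoods in the subspace [A] are also neighbourhoods in
    [T], so continuity of the subtype map passes to [g]. This gives continuity of [eta], as a
    function on [R], at positive points. *)
Lemma homeomorphism_on_continuous (T U : topologicalType) (A : set T)
    (B : set U) (g : T -> U) (x : T) :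
  homeomorphism_on A B g -> A° x -> {for x, continuous g}.
Proof.
move=> [h [hc _] hE] Ax W gxW.
have Ax' : x \in A by rewrite inE; exact: nbhs_singleton.
pose x' : A := exist _ x Ax'.
have : nbhs x' ((set_val \o h) @^-1` W).
  apply: (continuous_comp (hc x') (@initial_continuous _ _ set_val (h x'))).
  by rewrite /= [set_val _](hE x').
move=> [_ [[V oV <-] /= Vx] VW].
have nV : nbhs x V by exact: open_nbhs_nbhs.
apply: filterS (filterI nV Ax) => y [Vy Ay].
have Ay' : y \in A by rewrite inE.
by have := VW (exist _ y Ay') Vy; rewrite /= [set_val _]hE.
Qed.

Section diameter.
Context {R : realType} (X : metricType R).
Implicit Types (A B : set X) (x y : X).

Lemma diam_ge0 A x : A x -> (0 <= diam A)%E.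
Proof.
move=> Ax; apply: ereal_sup_ubound.
by exists x => //; exists x; rewrite // mdistxx.
Qed.

Lemma diam_fineK A x : A x -> (diam A < +oo)%E -> (fine (diam A))%:E = diam A.
Proof. by move=> Ax Aoo; rewrite fineK// ge0_fin_numE// (diam_ge0 Ax). Qed.

Lemma mdist_le_diam A x y : A x -> A y -> (diam A < +oo)%E ->
  mdist x y <= fine (diam A).
Proof.
move=> Ax Ay Aoo; rewrite -lee_fin (diam_fineK Ax Aoo).
by apply: ereal_sup_ubound; exists x => //; exists y.
Qed.

Lemma le_diam A B : A `<=` B -> (diam A <= diam B)%E.
Proof.
move=> AB; apply: ereal_sup_le => _ [x Ax [y Ay <-]].
by exists x; [exact: AB|exists y; [exact: AB|]].
Qed.

Lemma diam_gt0_neq A : (0 < diam A)%E -> exists x y, [/\ A x, A y & x != y].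
Proof.
move=> /ereal_sup_gt[_ [x Ax [y Ay <-]]]; rewrite lte_fin mdist_gt0 => xy.
by exists x, y.
Qed.

Lemma diam_neq_gt0 A x y : A x -> A y -> x != y -> (0 < diam A)%E.
Proof.
move=> Ax Ay xy; apply: (@lt_le_trans _ _ (mdist x y)%:E).
  by rewrite lte_fin mdist_gt0.
by apply: ereal_sup_ubound; exists x => //; exists y.
Qed.

Hypothesis ultraX : ultrametric X.

(** The strong triangle inequality through [x] bounds each distance in [A] by the larger of two
    distances to [x], without the factor 2 of a general metric space. *)
Lemma ultrametric_diam_le A x (M : R) :
  (forall y, A y -> mdist x y <= M) -> (diam A <= M%:E)%E.
Proof.
move=> xM; apply: ge_ereal_sup => _ [y Ay [z Az <-]].
by rewrite lee_fin (le_trans (ultraX y z x))// ge_max metric_sym !xM.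
Qed.

Lemma ultrametric_diam_gt A x (r : R) : (r%:E < diam A)%E ->
  exists2 y, A y & r < mdist x y.
Proof.
move=> rA; apply: contrapT => Nr; move: rA; apply/negP; rewrite -leNgt.
apply: (ultrametric_diam_le (x := x)) => y Ay.
by rewrite leNgt; apply/negP => ry; apply: Nr; exists y.
Qed.

End diameter.

Section quasisymmetric.
Context {R : realType} (X Y : metricType R).
Hypotheses (ultraX : ultrametric X) (ultraY : ultrametric Y).
Variables (eta : R -> R) (f : X -> Y).
Hypothesis eta_homeo :
  homeomorphism_on (`[0, +oo[%classic : set R) (`[0, +oo[%classic : set R) eta.
Hypothesis f_qs : quasisymmetric_embedding eta f.

(** Fix [a], [b] in [A] with distinct images. For [c] in [A], the distance from [a] to [c] is at
    most diam A = (diam A / d(a, b)) d(a, b), so quasisymmetry puts [f c] within a fixed distance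
    [M] of [f a]. *)
Lemma quasisymmetric_bounded (A : set X) :
  metric_bounded A -> metric_bounded (f @` A).
Proof.
rewrite /metric_bounded => Aoo.
have [/diam_gt0_neq[x [y [Ax Ay xy]]]|] := boolP (0 < diam (f @` A))%E; last first.
  by rewrite -leNgt => /le_lt_trans; apply; rewrite ltry.
case: Ax Ay xy => a Aa <- [b Ab <-] ab.
have dab : 0 < mdist a b by rewrite mdist_gt0; apply: contra_neq ab => ->.
have D0 : 0 < fine (diam A) by rewrite (lt_le_trans dab)// mdist_le_diam.
set M := eta (fine (diam A) / mdist a b) * mdist (f a) (f b).
apply: (@le_lt_trans _ _ M%:E); last by rewrite ltry.
apply: (ultrametric_diam_le ultraY (x := f a)) => _ [c Ac <-].
apply: f_qs.2; first by rewrite divr_gt0.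
by rewrite divfK ?gt_eqF// mdist_le_diam.
Qed.

(* The lower and upper bounds of the theorem are the cases (P, Q) = (B, A) and
   (P, Q) = (A, B). *)
Lemma quasisymmetric_diam_le (P Q : set X) (x : X) : P x -> Q x ->
  (0 < diam P < +oo)%E -> (0 < diam Q < +oo)%E ->
  fine (diam (f @` P)) <=
    eta (fine (diam P) / fine (diam Q)) * fine (diam (f @` Q)).
Proof.
move=> Px Qx /andP[P0 Poo] /andP[Q0 Qoo].
have fPoo := quasisymmetric_bounded Poo.
have fQoo := quasisymmetric_bounded Qoo.
have fQx : (f @` Q) (f x) by exists x.
have fPx : (f @` P) (f x) by exists x.
set p := fine (diam P); set q := fine (diam Q); set q' := fine (diam (f @` Q)).
have p0 : 0 < p by rewrite -lte_fin (diam_fineK Px).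
have q0 : 0 < q by rewrite -lte_fin (diam_fineK Qx).
rewrite -lee_fin (diam_fineK fPx)//.
apply: (ultrametric_diam_le ultraY (x := f x)) => _ [a Pa <-].
have etac : (fun s => eta (p / s) * q') @ q --> eta (p / q) * q'.
  apply: cvgMr_tmp.
  apply: (@cvg_comp _ _ _ (fun s => p / s) eta _ (nbhs (p / q))).
    by apply: cvgM; [exact: cvg_cst|apply: cvgV; [rewrite gt_eqF|exact: cvg_id]].
  (* Since [p / q] is positive, it is interior to the half-line on which [eta] is a
     homeomorphism. *)
  apply: (homeomorphism_on_continuous eta_homeo).
  have : (`]0, +oo[%classic : set R) (p / q).
    by rewrite /= in_itv /= andbT divr_gt0.
  move=> pq; apply: (@filterS _ _ _ `]0, +oo[%classic).
    by move=> s /=; rewrite !in_itv /= !andbT => /ltW.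
  by apply: open_nbhs_nbhs; split=> //; exact: interval_open.
apply/ler_addgt0Pr => e e0.
have : nbhs q [set s | `|eta (p / q) * q' - eta (p / s) * q'| < e].
  by move: etac => /cvgrPdist_lt/(_ _ e0).
move=> /nbhs_ballP[d /= d0 dP].
(* The bound [q - d] puts [mdist x b] in the ball where [dP] applies; the bound 0 allows division by
   it. *)
have [b Qb] : exists2 b, Q b & Num.max 0 (q - d) < mdist x b.
  apply: ultrametric_diam_gt => //; rewrite -(diam_fineK Qx)// lte_fin.
  by rewrite gt_max q0 gtrBl.
rewrite gt_max => /andP[xb0 qdb].
have xbq : mdist x b <= q by exact: mdist_le_diam.
have /dP : ball q d (mdist x b).
  by rewrite -ball_normE /= ger0_norm ?subr_ge0// ltrBlDr -ltrBlDl.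
rewrite /= distrC => /ltr_distlDr/ltW; apply: le_trans.
apply: (@le_trans _ _ (eta (p / mdist x b) * mdist (f x) (f b))).
  by apply: f_qs.2; [rewrite divr_gt0|rewrite divfK ?gt_eqF// mdist_le_diam].
have fQb : (f @` Q) (f b) by exists b.
apply: ler_wpM2l; last exact: mdist_le_diam.
(* It remains to see that [eta (p / mdist x b)] is nonnegative. Quasisymmetry with [a] equal to [x]
   gives 0 <= eta(p / d(x, b)) rho(f x, f b), and the last factor is positive by injectivity. *)
have fxb0 : 0 < mdist (f x) (f b).
  rewrite mdist_gt0; move: xb0; rewrite mdist_gt0; apply: contra_neq.
  by case: f_qs.1 => + _ _; apply.
rewrite -(@ler_pM2r _ (mdist (f x) (f b)))// mul0r.
apply: (@le_trans _ _ (mdist (f x) (f x))); first exact: mdist_ge0.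
apply: f_qs.2; first by rewrite divr_gt0.
by rewrite mdistxx mulr_ge0 ?divr_ge0 ?mdist_ge0 // ltW.
Qed.

End quasisymmetric.

Theorem theorem2p2 (R : realType) (X Y : metricType R)
    (ultraX : ultrametric X) (ultraY : ultrametric Y)
    (eta : R -> R)
    (eta_homeo :
      homeomorphism_on (`[0, +oo[%classic : set R) (`[0, +oo[%classic : set R) eta)
    (f : X -> Y) (f_qs : quasisymmetric_embedding eta f) :
  (forall A : set X, metric_bounded A -> metric_bounded (f @` A)) /\
  (forall A B : set X, A `<=` B -> (0 < diam A)%E -> (diam B < +oo)%E ->
    [/\ (diam (f @` B) < +oo)%E,
        (eta (fine (diam B) / fine (diam A)))^-1
          <= fine (diam (f @` A)) / fine (diam (f @` B))
      & fine (diam (f @` A)) / fine (diam (f @` B))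
          <= eta (fine (diam A) / fine (diam B))]).
Proof.
split=> [A|A B AB A0 Boo]; first exact: (quasisymmetric_bounded ultraY f_qs).
have Aoo : (diam A < +oo)%E := le_lt_trans (le_diam AB) Boo.
have B0 : (0 < diam B)%E := lt_le_trans A0 (le_diam AB).
(* Injectivity makes the image diameter positive, and boundedness keeps [fine] from sending it to
   the default 0. *)
have fdiam_gt0 C : (0 < diam C < +oo)%E -> 0 < fine (diam (f @` C)).
  move=> /andP[/diam_gt0_neq[u [v [Cu Cv uv]]] Coo].
  have fCoo := quasisymmetric_bounded ultraY f_qs Coo.
  have fCu : (f @` C) (f u) by exists u.
  rewrite -lte_fin (diam_fineK fCu)//.
  apply: (@diam_neq_gt0 _ _ _ (f u) (f v)) => //.
  by apply: contra_neq uv; case: f_qs.1 => + _ _; apply.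
have A0oo : (0 < diam A < +oo)%E by rewrite A0.
have B0oo : (0 < diam B < +oo)%E by rewrite B0.
have [x [_ [Ax _ _]]] := diam_gt0_neq A0.
have diam_le P Q :=
  @quasisymmetric_diam_le _ _ _ ultraX ultraY _ _ eta_homeo f_qs P Q x.
have fA0 := fdiam_gt0 A A0oo; have fB0 := fdiam_gt0 B B0oo.
have BA := diam_le B A (AB _ Ax) Ax B0oo A0oo.
split; first exact: (quasisymmetric_bounded ultraY f_qs).
  (* Inverting both sides turns the lower bound into [BA]. *)
  rewrite -[leRHS]invf_div lef_pV2 ?posrE ?divr_gt0//.
    by rewrite ler_pdivrMr.
  (* The value of [eta] is positive because [BA] bounds a positive number by its product with diam
     f(A). *)
  by rewrite -(pmulr_lgt0 _ fA0) (lt_le_trans fB0).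
by rewrite ler_pdivrMr// diam_le //; exact: AB.
Qed.
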